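(* Let $\bar Z$ span an extreme ray of $\mathcal{C}_2$. If $r=\operatorname{rank}(\bar Z)>1$, then there exist $x^1,\ldots,x^r\in\mathbb{R}^n$ and $\alpha_1,\ldots,\alpha_r>0$ such that $$\bar Z=\sum_{i=1}^r \alpha_i\begin{bmatrix} x^i\\ \|x^i\|_2^2\\ 1\end{bmatrix}\begin{bmatrix} x^i\\ \|x^i\|_2^2\\ 1\end{bmatrix}^\top,$$ where $\|x^1-c^1\|_2<r_1$, $\|x^1-c^2\|_2<r_2$, $\|x^i-c^1\|_2=r_1$ for all $2\le i\le r$, and $P\bar Zd^2\in\operatorname{bd}(\mathbb{L}^{n+2})$.
   Context: Let $n\ge 1$ and let $c^1,c^2\in\mathbb{R}^n$, $r_1,r_2\in\mathbb{R}$ be such that $S:=\{x\in\mathbb{R}^n: \|x-c^i\|_2\le r_i,\ i=1,2\}$ is nonempty. $\mathbb{S}^k$ is the space of real symmetric $k\times k$ matrices, $\mathbb{S}^k_+$ the cone of positive semidefinite ones, and $\langle A,B\rangle=\operatorname{tr}(AB)$. $\operatorname{bd}(\cdot)$ denotes the boundary of a set. The second-order cone is $\mathbb{L}^{n+2}:=\{x\in\mathbb{R}^{n+2}: \|(x_1,\ldots,x_{n+1})\|_2\le x_{n+2}\}$. With $I$ the $n\times n$ identity, define $$Q:=\begin{bmatrix}-2I & 0 & 0\\0 & 0 & 1\\0 & 1 & 0\end{bmatrix},\quad P:=\begin{bmatrix}2I & 0 & 0\\ 0 & 1 & -1\\0 & 1 & 1\end{bmatrix},\quad d^i:=\begin{bmatrix}2c^i\\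 -1\\ r_i^2-\|c^i\|_2^2\end{bmatrix}\in\mathbb{R}^{n+2},\ i=1,2,$$ $$\mathcal{C}_2:=\{Z\in\mathbb{S}^{n+2}_+:\ \langle Q,Z\rangle=0,\ PZd^1\in\mathbb{L}^{n+2},\ PZd^2\in\mathbb{L}^{n+2},\ (d^1)^\top Zd^2\ge 0\}.$$ A nonzero $\bar Z\in\mathcal{C}_2$ spans an extreme ray of the convex cone $\mathcal{C}_2$ if $\bar Z=A+B$ with $A,B\in\mathcal{C}_2$ implies that $A$ and $B$ are nonnegative multiples of $\bar Z$. *)

(* Defs.v *)
From HB Require Import structures.
From mathcomp Require Import all_boot all_order all_algebra.
From mathcomp Require Import all_classical reals topology.

Set Implicit Arguments.
Unset Strict Implicit.
Unset Printing Implicit Defensive.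

Import Order.TTheory GRing.Theory Num.Theory.
Import numFieldTopology.Exports.

Local Open Scope classical_set_scope.
Local Open Scope ring_scope.

(* The library's norm on matrices is the sup norm, so the Euclidean norm is
   defined here; both induce the topology used in [bd]. *)
Definition norm2 (R : realType) (m : nat) (x : 'cV[R]_m) : R :=
  Num.sqrt (\sum_(i < m) x i 0 ^+ 2).

Definition bd (T : topologicalType) (A : set T) : set T := closure A `\` A°.

Definition psd (R : realType) (m : nat) : set 'M[R]_m :=
  [set Z | Z^T = Z /\ forall v : 'cV[R]_m, 0 <= (v^T *m Z *m v) 0 0].

Definition mxinner (R : realType) (m : nat) (A B : 'M[R]_m) : R :=
  \tr (A *m B).

Definition lorentz (R : realType) (m : nat) : set 'cV[R]_(m + 1) :=
  [set v | norm2 (usubmx v) <= dsubmx v 0 0].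

(* R^(n+2) is indexed by n + 1 + 1, so that the 3 x 3 block matrices are nested
   2 x 2 blocks and the last coordinate is the distinguished one in
   [lorentz]. *)
Definition Qmx (R : realType) (n : nat) : 'M[R]_(n + 1 + 1) :=
  block_mx (block_mx (- 2)%:M 0
                     0        0)  (col_mx 0 1%:M)
           (row_mx   0        1%:M)  0.

Definition Pmx (R : realType) (n : nat) : 'M[R]_(n + 1 + 1) :=
  block_mx (block_mx 2%:M 0
                     0    1%:M)  (col_mx 0 (- 1)%:M)
           (row_mx   0    1%:M)  1%:M.

Definition dvec (R : realType) (n : nat) (c : 'cV[R]_n) (r : R) :
    'cV[R]_(n + 1 + 1) :=
  col_mx (col_mx (2 *: c) (- 1)%:M) (r ^+ 2 - norm2 c ^+ 2)%:M.

Definition paraboloid_lift (R : realType) (n : nat) (x : 'cV[R]_n) :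
    'cV[R]_(n + 1 + 1) :=
  col_mx (col_mx x (norm2 x ^+ 2)%:M) 1%:M.

Definition C2 (R : realType) (n : nat) (c1 c2 : 'cV[R]_n) (r1 r2 : R) :
    set 'M[R]_(n + 1 + 1) :=
  [set Z | [/\ psd Z,
               mxinner (Qmx R n) Z = 0,
               lorentz (Pmx R n *m Z *m dvec c1 r1),
               lorentz (Pmx R n *m Z *m dvec c2 r2)
             & 0 <= ((dvec c1 r1)^T *m Z *m dvec c2 r2) 0 0]].

Definition spans_extreme_ray (R : realType) (V : lmodType R) (C : set V)
    (z : V) : Prop :=
  [/\ C z, z != 0
    & forall a b : V, C a -> C b -> z = a + b ->
        (exists2 s : R, 0 <= s & a = s *: z) /\
        (exists2 t : R, 0 <= t & b = t *: z)].

(* Main.v *)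
Require Import Defs.
From HB Require Import structures.
From mathcomp Require Import all_boot all_order all_algebra.
From mathcomp Require Import all_classical reals topology.
From mathcomp Require Import ring lra.

Set Implicit Arguments.
Unset Strict Implicit.
Unset Printing Implicit Defensive.

Import Order.TTheory GRing.Theory Num.Theory.
Import numFieldTopology.Exports.

Local Open Scope classical_set_scope.
Local Open Scope ring_scope.

(* Write q for the quadratic form of Q. Then P w lies in the Lorentz cone iff
   q w >= 0 and the last two coordinates of w have nonnegative sum, and on the
   boundary iff moreover q w = 0. A positive semidefinite Z of rank r with
   <Q, Z> = 0 is a sum of r outer products z_i z_i^T with q z_i = 0 (Sturm and
   Zhang), so any D = sum_i e_i z_i z_i^T keeps <Q, Z + t D> = 0 and keeps
   Z + t D positive semidefinite for small t. If every constraint of C_2 that is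
   active at Z is preserved by D, extremality makes D a multiple of Z, hence e
   constant. Choosing e supported on one or two indices shows in turn that
   q (Z d^1) = q (Z d^2) = 0 and that d^1 . Z d^2 > 0.
   When q (Z d^1) = 0, splitting off the rank one term along Z d^1 first gives a
   decomposition with d^1 . z_i = 0 for all i but one; that one is proportional
   to Z d^1 and yields the interior point, the others the points on the first
   sphere. *)

(** * Bilinear forms, outer products and positive semidefinite matrices *)

Definition dot (R : realType) m (u v : 'cV[R]_m) : R := (u^T *m v) 0 0.

Definition bil (R : realType) m (A : 'M[R]_m) (u v : 'cV[R]_m) : R :=
  (u^T *m A *m v) 0 0.

Section Bilinear.
Variables (R : realType) (m : nat).
Implicit Types (u v w : 'cV[R]_m) (A B : 'M[R]_m).

Lemma dotE u v : dot u v = \sum_i u i 0 * v i 0.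
Proof. by rewrite /dot mxE; apply: eq_bigr => i _; rewrite mxE. Qed.

Lemma dotC u v : dot u v = dot v u.
Proof. by rewrite !dotE; apply: eq_bigr => i _; rewrite mulrC. Qed.

Lemma dotZr a u v : dot u (a *: v) = a * dot u v.
Proof. by rewrite /dot -scalemxAr mxE. Qed.

Lemma dotZl a u v : dot (a *: u) v = a * dot u v.
Proof. by rewrite dotC dotZr dotC. Qed.

Lemma dotBr u v w : dot u (v - w) = dot u v - dot u w.
Proof. by rewrite !dotE -sumrB; apply: eq_bigr => i _; rewrite !mxE mulrBr. Qed.

Lemma dot_ge0 u : 0 <= dot u u.
Proof. by rewrite dotE sumr_ge0 // => i _; rewrite -expr2 sqr_ge0. Qed.

Lemma dot_eq0 u : dot u u = 0 -> u = 0.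
Proof.
rewrite dotE => /eqP; rewrite psumr_eq0; last first.
  by move=> i _; rewrite -expr2 sqr_ge0.
move=> /allP u0; apply/matrixP => i j; rewrite ord1 mxE.
by have /= := u0 i (mem_index_enum i); rewrite mulf_eq0 orbb => /eqP.
Qed.

Lemma norm2_sqr u : norm2 u ^+ 2 = dot u u.
Proof.
rewrite sqr_sqrtr; last by apply: sumr_ge0 => i _; apply: sqr_ge0.
by rewrite dotE; apply: eq_bigr => i _; rewrite expr2.
Qed.

Lemma norm2_ge0 u : 0 <= norm2 u.
Proof. exact: sqrtr_ge0. Qed.

Lemma bilDr A u v w : bil A u (v + w) = bil A u v + bil A u w.
Proof. by rewrite /bil mulmxDr mxE. Qed.

Lemma bilDl A u v w : bil A (v + w) u = bil A v u + bil A w u.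
Proof. by rewrite /bil linearD /= !mulmxDl mxE. Qed.

Lemma bilZr A a u v : bil A u (a *: v) = a * bil A u v.
Proof. by rewrite /bil -scalemxAr mxE. Qed.

Lemma bilZl A a u v : bil A (a *: u) v = a * bil A u v.
Proof. by rewrite /bil linearZ /= -!scalemxAl mxE. Qed.

Lemma bilDm A B u v : bil (A + B) u v = bil A u v + bil B u v.
Proof. by rewrite /bil mulmxDr mulmxDl mxE. Qed.

Lemma bilZm A a u v : bil (a *: A) u v = a * bil A u v.
Proof. by rewrite /bil -scalemxAr -scalemxAl mxE. Qed.

Lemma bil_summ (I : finType) (F : I -> 'M[R]_m) u v :
  bil (\sum_i F i) u v = \sum_i bil (F i) u v.
Proof. by rewrite /bil mulmx_sumr mulmx_suml summxE. Qed.

Lemma bilC A u v : A^T = A -> bil A u v = bil A v u.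
Proof.
move=> sA; rewrite /bil.
have -> : u^T *m A *m v = (v^T *m A^T *m u)^T by rewrite !trmx_mul !trmxK mulmxA.
by rewrite mxE sA.
Qed.

Lemma bil_dot A u v : bil A u v = dot u (A *m v).
Proof. by rewrite /bil /dot mulmxA. Qed.

Lemma outer_mul u v : u *m u^T *m v = dot u v *: u.
Proof.
by rewrite -mulmxA [u^T *m v]mx11_scalar mul_mx_scalar.
Qed.

Lemma bil_outer u v w : bil (u *m u^T) v w = dot u v * dot u w.
Proof. by rewrite bil_dot outer_mul dotZr mulrC dotC. Qed.

Lemma outer_sum_mul r (e : 'I_r -> R) (z : 'I_r -> 'cV[R]_m) v :
  (\sum_i e i *: (z i *m (z i)^T)) *m v = \sum_i (e i * dot (z i) v) *: z i.
Proof.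
by rewrite mulmx_suml; apply: eq_bigr => i _; rewrite -scalemxAl outer_mul scalerA.
Qed.

Lemma bil_outer_sum r (e : 'I_r -> R) (z : 'I_r -> 'cV[R]_m) v w :
  bil (\sum_i e i *: (z i *m (z i)^T)) v w
  = \sum_i e i * (dot (z i) v * dot (z i) w).
Proof. by rewrite bil_summ; apply: eq_bigr => i _; rewrite bilZm bil_outer. Qed.

Lemma mxinner_outer A u : mxinner A (u *m u^T) = bil A u u.
Proof. by rewrite /mxinner mulmxA mxtrace_mulC mulmxA /mxtrace big_ord1. Qed.

Lemma mxinnerD A B C : mxinner A (B + C) = mxinner A B + mxinner A C.
Proof. by rewrite /mxinner mulmxDr mxtraceD. Qed.

Lemma mxinnerZ A a B : mxinner A (a *: B) = a * mxinner A B.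
Proof. by rewrite /mxinner -scalemxAr mxtraceZ. Qed.

Lemma mxinner_outer_sum A r (e : 'I_r -> R) (z : 'I_r -> 'cV[R]_m) :
  mxinner A (\sum_i e i *: (z i *m (z i)^T)) = \sum_i e i * bil A (z i) (z i).
Proof.
rewrite /mxinner mulmx_sumr raddf_sum; apply: eq_bigr => i _ /=.
by rewrite -/(mxinner _ _) mxinnerZ mxinner_outer.
Qed.

Lemma outer_sum1 r (z : 'I_r -> 'cV[R]_m) :
  \sum_i z i *m (z i)^T = \sum_i (1 : R) *: (z i *m (z i)^T).
Proof. by apply: eq_bigr => i _; rewrite scale1r. Qed.

Lemma psd_outer_sum r (e : 'I_r -> R) (z : 'I_r -> 'cV[R]_m) :
  (forall i, 0 <= e i) -> psd (\sum_i e i *: (z i *m (z i)^T)).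
Proof.
move=> e0; split.
  rewrite raddf_sum; apply: eq_bigr => i _ /=.
  by rewrite linearZ /= trmx_mul trmxK.
move=> v; rewrite -/(bil _ v v) bil_outer_sum sumr_ge0 // => i _.
by rewrite mulr_ge0 // -expr2 sqr_ge0.
Qed.

Lemma psdZ a A : 0 <= a -> psd A -> psd (a *: A).
Proof.
move=> a0 [sA pA]; split; first by rewrite linearZ /= sA.
by move=> v; rewrite -/(bil _ v v) bilZm mulr_ge0 //; apply: pA.
Qed.

(** Along [d + t *: (A *m d)] the form has no constant term, so its nonnegativity for all [t] forces
    the coefficient of [t], twice the squared length of [A *m d], to vanish. *)
Lemma psd_ker A d : psd A -> bil A d d = 0 -> A *m d = 0.
Proof.
move=> [sA pA] d0; apply: dot_eq0; set y := A *m d.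
have h (t : R) : 0 <= 2 * t * dot y y + t ^+ 2 * bil A y y.
  have := pA (d + t *: y); rewrite -/(bil _ _ _).
  rewrite !(bilDl, bilDr, bilZl, bilZr) d0 (bilC d y sA) (bil_dot A y d) -/y.
  by move=> H; apply: le_trans H _; rewrite le_eqVlt; apply/orP; left; apply/eqP; ring.
have := dot_ge0 y; set a := dot y y in h *; set b := bil A y y in h *.
have b0 : 0 <= b by apply: pA.
rewrite le_eqVlt => /orP[/eqP // |a0]; exfalso.
have b1 : 0 < 1 + b by lra.
(* The minimizer would be [- (a / b)]; the denominator [1 + b] cannot vanish and still gives a
   negative value. *)
have := h (- (a / (1 + b))); apply/negP; rewrite -ltNge.
have -> : 2 * - (a / (1 + b)) * a + (- (a / (1 + b))) ^+ 2 * b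
  = - (a ^+ 2 * (2 + b) / (1 + b) ^+ 2) by field; rewrite gt_eqF.
rewrite oppr_lt0 divr_gt0 ?exprn_gt0 // mulr_gt0 ?exprn_gt0 //; lra.
Qed.

(** The Schur complement of [A] along [d], which splits off the rank one term spanned by
    [A *m d]. *)
Definition deflate A d : 'M[R]_m :=
  A - (bil A d d)^-1 *: ((A *m d) *m (A *m d)^T).

Lemma deflate_mul A d : bil A d d != 0 -> A^T = A -> deflate A d *m d = 0.
Proof.
move=> d0 sA; rewrite mulmxBl -scalemxAl outer_mul dotC -bil_dot scalerA.
by rewrite mulVf // scale1r subrr.
Qed.

(** The value at [v] is the minimum of the form of [A] on the line through [v] in direction [d]. *)
Lemma psd_deflate A d : psd A -> bil A d d != 0 -> psd (deflate A d).
Proof.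
move=> [sA pA] d0; split.
  by rewrite linearB linearZ /= trmx_mul trmxK sA.
move=> v; have := pA (v + (- (bil A d v / bil A d d)) *: d).
rewrite -!/(bil _ _ _) /deflate -scaleNr bilDm bilZm bil_outer.
rewrite !(bilDl, bilDr, bilZl, bilZr) (dotC _ v) -bil_dot (bilC v d sA).
by congr (0 <= _); field.
Qed.

(** A rank one change lowers the rank by at most one. It does drop: the new row space lies in that
    of [A], and equality would make [A] kill [d], as [deflate A d] does. *)
Lemma rank_deflate A d :
  A^T = A -> bil A d d != 0 -> \rank A = (\rank (deflate A d)).+1.
Proof.
move=> sA d0; apply/eqP; rewrite eqn_leq; apply/andP; split.
  have {1}-> : A = deflate A d + (bil A d d)^-1 *: ((A *m d) *m (A *m d)^T).
    by rewrite subrK.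
  apply: leq_trans (mxrank_add _ _) _; rewrite -[leqRHS]addn1 leq_add2l.
  apply: leq_trans (mxrank_scale _ _) _; exact: mulmx_max_rank.
apply: rank_ltmx; rewrite /ltmx; apply/andP; split.
  apply/submxP; exists (1%:M - (bil A d d)^-1 *: (A *m d *m d^T)).
  by rewrite /deflate mulmxBl mul1mx -scalemxAl trmx_mul sA !mulmxA.
apply/negP => /submxP [C AC]; move/eqP: (d0); apply; rewrite bil_dot.
have -> : A *m d = C *m (deflate A d *m d) by rewrite mulmxA -AC.
by rewrite deflate_mul // mulmx0 /dot mulmx0 mxE.
Qed.

(** Induction on the rank, deflating along some [d] with nonzero form; without such a [d], [psd_ker]
    would kill every basis vector. *)
Lemma psd_decomp r A : psd A -> \rank A = r ->
  exists z : 'I_r -> 'cV[R]_m, A = \sum_i z i *m (z i)^T.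
Proof.
elim: r A => [|r IH] A pA rA.
  exists (fun=> 0); rewrite big_ord0; apply/eqP; by rewrite -mxrank_eq0 rA.
have [sA psA] := pA.
have [d d0] : exists d, bil A d d != 0.
  apply: contrapT => /forallNP H.
  suff A0 : A = 0 by move: rA; rewrite A0 mxrank0.
  apply/matrixP => i j; rewrite mxE.
  have : A *m (delta_mx j 0 : 'cV[R]_m) = 0.
    by apply: psd_ker => //; apply/eqP; have /negP := H (delta_mx j 0); rewrite negbK.
  by move=> /matrixP /(_ i 0); rewrite -colE !mxE.
have := rank_deflate sA d0; rewrite rA => -[] /esym /(IH _ (psd_deflate pA d0)) [z zE].
have dp : 0 < bil A d d by rewrite lt_neqAle eq_sym d0; apply: psA.
exists (fun i => if unlift ord0 i is Some j then z j
                 else (Num.sqrt (bil A d d))^-1 *: (A *m d)).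
rewrite big_ord_recl unlift_none; under eq_bigr do rewrite liftK.
rewrite -zE linearZ /= -scalemxAl -scalemxAr scalerA -invfM -expr2 sqr_sqrtr ?ltW //.
by rewrite addrC subrK.
Qed.

End Bilinear.

(** * Decompositions into isotropic rank one terms *)

Section NullDecomposition.
Variables (R : realType) (m : nat).
Implicit Types (u v w : 'cV[R]_m) (A Q : 'M[R]_m).

(** The pair is rotated by an angle with cosine [c] and tangent [t]. *)
Lemma rotate_outer (c t : R) u w : c ^+ 2 * (1 + t ^+ 2) = 1 ->
  (c *: (u + t *: w)) *m (c *: (u + t *: w))^T
  + (c *: (w - t *: u)) *m (c *: (w - t *: u))^T = u *m u^T + w *m w^T.
Proof.
move=> ct; apply/matrixP => i j; rewrite !mxE !big_ord1 !mxE.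
rewrite -[RHS]mul1r -ct; ring.
Qed.

Lemma rotate_isotropic Q u w : Q^T = Q -> 0 < bil Q u u -> bil Q w w < 0 ->
  exists c t : R, c ^+ 2 * (1 + t ^+ 2) = 1 /\
    bil Q (c *: (u + t *: w)) (c *: (u + t *: w)) = 0.
Proof.
move=> sQ u0 w0.
set a := bil Q u u in u0; set b := bil Q u w; set d := bil Q w w in w0.
have D0 : 0 <= b ^+ 2 - a * d.
  by rewrite subr_ge0 (le_trans _ (sqr_ge0 b)) // pmulr_rle0 // ltW.
(* A root of [a + 2 * b * t + d * t ^+ 2], real because [a] and [d] have opposite signs. *)
pose t := (- b + Num.sqrt (b ^+ 2 - a * d)) / d.
have t2 : 0 < 1 + t ^+ 2 by rewrite ltr_pwDl // sqr_ge0.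
exists (Num.sqrt (1 + t ^+ 2))^-1, t; split.
  by rewrite exprVn sqr_sqrtr ?ltW // mulVf // gt_eqF.
rewrite bilZl bilZr !(bilDl, bilDr, bilZl, bilZr) (bilC w u sQ) -/a -/b -/d.
suff -> : a + t * b + (t * b + t * (t * d)) = 0 by rewrite !mulr0.
have d0 : d != 0 by rewrite lt_eqF.
have := sqr_sqrtr D0; rewrite /t; set s := Num.sqrt _ => s2.
apply: (mulfI d0); rewrite mulr0.
transitivity (a * d - b ^+ 2 + s ^+ 2); first by field.
by rewrite s2; ring.
Qed.

Lemma sum0_gt0 (I : finType) (f : I -> R) i :
  \sum_j f j = 0 -> f i != 0 -> exists j, 0 < f j.
Proof.
move=> f0 fi; apply: contrapT => /forallNP H.
have : \sum_j - f j == 0 by rewrite sumrN f0 oppr0.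
rewrite psumr_eq0; last by move=> j _; rewrite oppr_ge0 leNgt; apply/negP.
move=> /allP /(_ i (mem_index_enum i)) /=; rewrite oppr_eq0 => fi0.
by rewrite fi0 in fi.
Qed.

(** Induction on the number of non-isotropic vectors. Since the values sum to zero, two of opposite
    sign exist; rotating them makes one isotropic and preserves the sum of outer products, hence the
    total of the values. *)
Lemma isotropic_decomp Q r (z : 'I_r -> 'cV[R]_m) :
    Q^T = Q -> \sum_i bil Q (z i) (z i) = 0 ->
  exists2 y : 'I_r -> 'cV[R]_m,
    \sum_i y i *m (y i)^T = \sum_i z i *m (z i)^T
    & forall i, bil Q (y i) (y i) = 0.
Proof.
move=> sQ; have [k] := ubnP #|[pred i | bil Q (z i) (z i) != 0]|.
elim: k z => // k IH z /ltnSE zk z0.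
have [[i0 zi0]|/forallNP none] := pselect (exists i, bil Q (z i) (z i) != 0);
  last by exists z => // i; apply/eqP/negPn/negP.
have [i zi] := sum0_gt0 z0 zi0.
have [j zj] : exists j, 0 < - bil Q (z j) (z j).
  by apply: (@sum0_gt0 _ _ i0); rewrite ?sumrN ?z0 ?oppr0 ?oppr_eq0.
rewrite oppr_gt0 in zj.
have ij : i != j by apply: contraTneq zi => ->; rewrite -leNgt ltW.
have [c [t [ct q0]]] := rotate_isotropic sQ zi zj.
pose y l := if l == i then c *: (z i + t *: z j)
            else if l == j then c *: (z j - t *: z i) else z l.
have yi : y i = c *: (z i + t *: z j) by rewrite /y eqxx.
have yj : y j = c *: (z j - t *: z i) by rewrite /y eqxx eq_sym (negPf ij).
have ol l : (l != i) && (l != j) -> y l = z l.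
  by rewrite /y => /andP[/negPf -> /negPf ->].
have yz : \sum_l y l *m (y l)^T = \sum_l z l *m (z l)^T.
  rewrite (bigD1 i) // (bigD1 j) //=; last by rewrite eq_sym.
  rewrite [in RHS](bigD1 i) // [in RHS](bigD1 j) //=; last by rewrite eq_sym.
  rewrite !addrA yi yj rotate_outer //; congr (_ + _).
  by apply: eq_bigr => l /ol ->.
have qsum (x : 'I_r -> 'cV[R]_m) :
    \sum_l bil Q (x l) (x l) = mxinner Q (\sum_l x l *m (x l)^T).
  by rewrite outer_sum1 mxinner_outer_sum; apply: eq_bigr => l _; rewrite mul1r.
have [||x xy xq] := IH y; last by exists x; rewrite // xy.
  (* Index [i] leaves the set of non-isotropic indices; [j] was already in it, so it may stay. *)
  apply: leq_trans zk; apply: proper_card; apply/properP; split.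
    apply/fintype.subsetP => l; rewrite !inE => yl.
    have [->|li] := eqVneq l i; first by rewrite gt_eqF.
    have [->|lj] := eqVneq l j; first by rewrite lt_eqF.
    by rewrite -ol // li lj.
  by exists i; rewrite !inE ?yi ?q0 ?eqxx // gt_eqF.
by rewrite qsum yz -qsum.
Qed.

(** The rank hypothesis makes the [z i] independent, so the columns of [pinvmx V] form a dual
    family; evaluating the form at its members reads off the coefficients. *)
Lemma outer_sum_inj r (z : 'I_r -> 'cV[R]_m) :
    \rank (\sum_i z i *m (z i)^T)%R = r ->
  forall f g : 'I_r -> R,
  \sum_i f i *: (z i *m (z i)^T) = \sum_i g i *: (z i *m (z i)^T) -> f =1 g.
Proof.
move=> rk f g fg.
pose V : 'M[R]_(r, m) := \matrix_(i, k) z i k 0.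
have zV : \sum_i z i *m (z i)^T = V^T *m V.
  apply/matrixP => k l; rewrite summxE !mxE; apply: eq_bigr => i _.
  by rewrite !mxE big_ord1 !mxE.
have Vfree : row_free V.
  by have := mxrankM_maxr V^T V; rewrite -zV rk /row_free eqn_leq rank_leq_row.
have VX : V *m pinvmx V = 1%:M by exact: mulmxVp.
have dzX i j : dot (z i) (col j (pinvmx V)) = (i == j)%:R.
  move/matrixP: VX => /(_ i j); rewrite [in RHS]mxE => <-.
  by rewrite dotE mxE; apply: eq_bigr => k _; rewrite !mxE.
have red (h : 'I_r -> R) j :
    bil (\sum_i h i *: (z i *m (z i)^T)) (col j (pinvmx V)) (col j (pinvmx V)) = h j.
  rewrite bil_outer_sum (bigD1 j) //= dzX eqxx !mulr1 big1 ?addr0 // => i ij.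
  by rewrite dzX (negPf ij) mul0r mulr0.
by move=> j; rewrite -(red f j) fg red.
Qed.

Lemma isotropic_psd_decomp Q A r : Q^T = Q -> psd A -> mxinner Q A = 0 ->
    \rank A = r ->
  exists2 z : 'I_r -> 'cV[R]_m,
    A = \sum_i z i *m (z i)^T & forall i, bil Q (z i) (z i) = 0.
Proof.
move=> sQ pA QA rA; have [z zE] := psd_decomp pA rA.
have [|y yE yQ] := @isotropic_decomp Q r z sQ.
  transitivity (mxinner Q A) => //; rewrite zE outer_sum1 mxinner_outer_sum.
  by apply: eq_bigr => i _; rewrite mul1r.
by exists y; rewrite // yE.
Qed.

Lemma outer_sum_ker r (z : 'I_r -> 'cV[R]_m) d :
  (\sum_i z i *m (z i)^T) *m d = 0 -> forall i, dot (z i) d = 0.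
Proof.
move=> zd; have : bil (\sum_i z i *m (z i)^T) d d = 0.
  by rewrite bil_dot zd /dot mulmx0 mxE.
rewrite outer_sum1 bil_outer_sum => /eqP; rewrite psumr_eq0; last first.
  by move=> i _; rewrite mul1r -expr2 sqr_ge0.
move=> /allP H i; have /= := H i (mem_index_enum i).
by rewrite mul1r mulf_eq0 orbb => /eqP.
Qed.

(** The term split off along [A *m d] is isotropic by hypothesis, so the deflated matrix keeps inner
    product zero with [Q]; it kills [d], so its vectors are orthogonal to [d]. If [bil A d d = 0],
    then [A *m d = 0] and every decomposition works. *)
Lemma isotropic_psd_decomp_at Q A d r : Q^T = Q -> psd A -> mxinner Q A = 0 ->
    bil Q (A *m d) (A *m d) = 0 -> \rank A = r.+1 ->
  exists z : 'I_r.+1 -> 'cV[R]_m,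
    [/\ A = \sum_i z i *m (z i)^T, forall i, bil Q (z i) (z i) = 0
      & forall i, i != ord0 -> dot (z i) d = 0].
Proof.
move=> sQ pA QA Qd rA; have [sA psA] := pA.
have [d0|d0] := eqVneq (bil A d d) 0.
  have [z zE zQ] := isotropic_psd_decomp sQ pA QA rA.
  exists z; split=> // i _; apply: outer_sum_ker; rewrite -zE; exact: psd_ker.
have dp : 0 < bil A d d by rewrite lt_neqAle eq_sym d0; apply: psA.
have := rank_deflate sA d0; rewrite rA => -[] /esym rd.
have [|z zE zQ] := isotropic_psd_decomp sQ (psd_deflate pA d0) _ rd.
  by rewrite /deflate -scaleNr mxinnerD mxinnerZ mxinner_outer QA Qd mulr0 addr0.
exists (fun i => if unlift ord0 i is Some j then z j
                 else (Num.sqrt (bil A d d))^-1 *: (A *m d)); split.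
- rewrite big_ord_recl unlift_none; under eq_bigr do rewrite liftK.
  rewrite -zE linearZ /= -scalemxAl -scalemxAr scalerA -invfM -expr2.
  by rewrite sqr_sqrtr ?ltW // addrC subrK.
- move=> i; case: unliftP => [j _|_]; first exact: zQ.
  by rewrite bilZl bilZr Qd !mulr0.
- move=> i; case: unliftP => [j _|-> /eqP //] _.
  by apply: outer_sum_ker; rewrite -zE deflate_mul.
Qed.

End NullDecomposition.

(** * Properties that hold near zero *)

(** The interval is closed and symmetric, so the radius and its opposite are themselves admissible
    parameters. *)
Definition small (R : realType) (P : R -> Prop) : Prop :=
  exists2 e : R, 0 < e & forall t, `|t| <= e -> P t.

Section Small.
Variable R : realType.

Lemma small_and (P P' : R -> Prop) : small P -> small P' -> small (fun t => P t /\ P' t).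
Proof.
move=> [e e0 Pe] [e' e'0 Pe']; exists (Num.min e e'); first by rewrite lt_min e0.
by move=> t; rewrite le_min => /andP[te te']; split; [apply: Pe|apply: Pe'].
Qed.

Lemma small_imp (P P' : R -> Prop) : (forall t, P t -> P' t) -> small P -> small P'.
Proof. by move=> PP' [e e0 Pe]; exists e => // t /Pe /PP'. Qed.

Lemma small_all r (F : 'I_r -> R -> Prop) :
  (forall i, small (F i)) -> small (fun t => forall i, F i t).
Proof.
move=> sF; have /boolp.choice[e /all_and2[e0 Fe]] :
  forall i, exists e, 0 < e /\ (forall t, `|t| <= e -> F i t).
  by move=> i; have [e] := sF i; exists e.
(* The default 1 keeps the radius positive when [r] is zero. *)
exists (\big[Num.min/1]_i e i).
  by elim/big_ind: _ => // x y x0 y0; rewrite lt_min x0.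
move=> t te i; apply: Fe; apply: le_trans te _.
by rewrite (bigD1 i) //= ge_min lexx.
Qed.

Lemma small_quad (a b c : R) :
  0 < a -> small (fun t => 0 <= a + t * b + t ^+ 2 * c).
Proof.
(* For [|t| <= 1] the two perturbing terms amount to at most [|t| * M]; the summand 1 makes [M]
   positive. *)
move=> a0; pose M := 1 + `|b| + `|c|.
have M1 : 1 <= M by rewrite /M -addrA lerDl addr_ge0.
have M0 : 0 < M by apply: lt_le_trans M1.
exists (Num.min 1 (a / M)); first by rewrite lt_min ltr01 divr_gt0.
move=> t; rewrite le_min ler_pdivlMr // => /andP[t1 tM].
have tb : `|t * b| <= `|t| * `|b| by rewrite normrM.
have tc : `|t ^+ 2 * c| <= `|t| * `|c|.
  rewrite normrM normrX expr2 -mulrA ler_piMl // mulr_ge0 //.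
have := lerNnormlW tb; have := lerNnormlW tc.
have t0 := normr_ge0 t.
by rewrite /M !mulrDr mulr1 in tM; lra.
Qed.

Lemma small_lin (a b : R) : 0 < a -> small (fun t => 0 <= a + t * b).
Proof.
move=> /(small_quad b 0); apply: small_imp => t.
by rewrite mulr0 addr0.
Qed.

End Small.

(** * Extreme rays over an abstract quadratic cone *)

Section QuadraticCone.
Variables (R : realType) (m : nat) (Q : 'M[R]_m) (l : 'cV[R]_m).
Hypothesis Qsym : Q^T = Q.
Hypothesis Ql : forall w, 0 < bil Q w w -> dot l w != 0.

(** Models the preimage of the Lorentz cone under [Pmx] (see [lorentz_Pmx]): [l] selects one of the
    two sheets of the double cone of [Q]. *)
Definition qcone : set 'cV[R]_m := [set w | 0 <= bil Q w w /\ 0 <= dot l w].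

Definition qC2 (d1 d2 : 'cV[R]_m) : set 'M[R]_m :=
  [set Z | [/\ psd Z, mxinner Q Z = 0, qcone (Z *m d1), qcone (Z *m d2)
             & 0 <= bil Z d1 d2]].

Implicit Types (d w y u : 'cV[R]_m) (Z D : 'M[R]_m).

Lemma qconeZ a w : 0 <= a -> qcone w -> qcone (a *: w).
Proof.
by move=> a0 [q0 l0]; split; rewrite ?bilZl ?bilZr ?dotZr !mulr_ge0.
Qed.

Lemma qC2Z d1 d2 a Z : 0 <= a -> qC2 d1 d2 Z -> qC2 d1 d2 (a *: Z).
Proof.
move=> a0 [pZ QZ k1 k2 k3]; split.
- exact: psdZ.
- by rewrite mxinnerZ QZ mulr0.
- by rewrite -scalemxAl; apply: qconeZ.
- by rewrite -scalemxAl; apply: qconeZ.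
- by rewrite bilZm mulr_ge0.
Qed.

Lemma qC2C d1 d2 : qC2 d1 d2 = qC2 d2 d1.
Proof.
apply/seteqP; split=> Z [pZ QZ k1 k2 k3]; split=> //.
- by rewrite bilC //; case: pZ.
- by rewrite bilC //; case: pZ.
Qed.

(** If the form is positive at [y], then [Ql] makes both cone conditions strict. Otherwise the point
    becomes [(1 + t * c) *: y] and stays on its ray. *)
Lemma qcone_small y u : qcone y ->
    0 < bil Q y y \/ (exists c, u = c *: y) ->
  small (fun t => qcone (y + t *: u)).
Proof.
move=> ky [qy|[c ->]]; last first.
  apply: small_imp (small_lin c ltr01) => t t0.
  by rewrite scalerA -[X in X + _]scale1r -scalerDl; apply: qconeZ.
have ly : 0 < dot l y by case: ky => _; rewrite le_eqVlt eq_sym (negPf (Ql qy)).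
apply: small_imp (small_and (small_quad (2 * bil Q y u) (bil Q u u) qy)
  (small_lin (dot l u) ly)) => t [qt lt]; split.
  rewrite !(bilDl, bilDr, bilZl, bilZr) (bilC u y Qsym).
  by apply: le_trans qt _; rewrite le_eqVlt; apply/orP; left; apply/eqP; ring.
by rewrite /dot mulmxDr mxE -/(dot l y) -/(dot l _) dotZr.
Qed.

Section Extreme.
Variables (d1 d2 : 'cV[R]_m) (Z : 'M[R]_m) (r : nat) (z : 'I_r -> 'cV[R]_m).
Hypothesis Zext : spans_extreme_ray (qC2 d1 d2) Z.
Hypothesis rkZ : \rank Z = r.
Hypothesis Zz : Z = \sum_i z i *m (z i)^T.
Hypothesis zQ : forall i, bil Q (z i) (z i) = 0.

(** Each alternative says that a constraint is slack at [Z] or is respected by [D]. The halves of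
    [Z + t *: D] and [Z - t *: D] then lie in [qC2] and sum to [Z]. *)
Lemma extreme_perturb (e : 'I_r -> R) D :
    D = \sum_i e i *: (z i *m (z i)^T) ->
    0 < bil Q (Z *m d1) (Z *m d1) \/ (exists c, D *m d1 = c *: (Z *m d1)) ->
    0 < bil Q (Z *m d2) (Z *m d2) \/ (exists c, D *m d2 = c *: (Z *m d2)) ->
    0 < bil Z d1 d2 \/ bil D d1 d2 = 0 ->
  exists c, forall i, e i = c.
Proof.
move=> De h1 h2 h3; have [[pZ QZ k1 k2 k3] _ ext] := Zext.
have s3 : small (fun t => 0 <= bil Z d1 d2 + t * bil D d1 d2).
  case: h3 => [|->]; first exact: small_lin.
  by exists 1 => // t _; rewrite mulr0 addr0.
have s0 := small_all (fun i => small_lin (e i) ltr01).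
have [t t0 Ht] : small (fun t => qC2 d1 d2 (Z + t *: D)).
  apply: small_imp (small_and (small_and s0 s3)
    (small_and (qcone_small k1 h1) (qcone_small k2 h2))).
  move=> t [[e0 b0] [kt1 kt2]].
  have ZD : Z + t *: D = \sum_i (1 + t * e i) *: (z i *m (z i)^T).
    rewrite Zz De scaler_sumr -big_split; apply: eq_bigr => i _ /=.
    by rewrite scalerDl scale1r scalerA.
  split.
  - by rewrite ZD; apply: psd_outer_sum.
  - by rewrite ZD mxinner_outer_sum big1 // => i _; rewrite zQ mulr0.
  - by rewrite mulmxDl -scalemxAl.
  - by rewrite mulmxDl -scalemxAl.
  - by rewrite bilDm bilZm.
have half : (0 : R) <= 2^-1 by rewrite invr_ge0.
have Cp : qC2 d1 d2 (2^-1 *: (Z + t *: D)).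
  by apply: qC2Z half _; apply: Ht; rewrite gtr0_norm.
have Cm : qC2 d1 d2 (2^-1 *: (Z + (- t) *: D)).
  by apply: qC2Z half _; apply: Ht; rewrite normrN gtr0_norm.
have [|[s _ sE] _] := ext _ _ Cp Cm.
  rewrite -scalerDr addrACA -scalerDl subrr scale0r addr0 -mulr2n -scaler_nat.
  by rewrite scalerA mulVf ?scale1r // pnatr_eq0.
(* Solves [2^-1 *: (Z + t *: D) = s *: Z] for [D]. *)
have DZ : D = ((2 * s - 1) / t) *: Z.
  have : t *: D = (2 * s - 1) *: Z.
    rewrite scalerBl scale1r -scalerA -sE scalerA divff ?pnatr_eq0 // scale1r.
    by rewrite addrC addKr.
  by move=> tD; rewrite [_ / t]mulrC -scalerA -tD scalerA mulVf ?scale1r // gt_eqF.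
exists ((2 * s - 1) / t) => i; move: i; apply: (@outer_sum_inj _ _ _ z) => //.
  by rewrite -Zz.
by rewrite -De {1}DZ {1}Zz scaler_sumr.
Qed.

(** Perturbation by the [i]-th term alone: its coefficients are 1 at [i] and 0 at [j], hence not
    constant. *)
Lemma extreme_term i j : i != j ->
    0 < bil Q (Z *m d1) (Z *m d1) \/ (exists c, dot (z i) d1 *: z i = c *: (Z *m d1)) ->
    0 < bil Q (Z *m d2) (Z *m d2) \/ (exists c, dot (z i) d2 *: z i = c *: (Z *m d2)) ->
    0 < bil Z d1 d2 \/ dot (z i) d1 * dot (z i) d2 = 0 ->
  False.
Proof.
move=> ij h1 h2 h3.
have De : z i *m (z i)^T = \sum_k (k == i)%:R *: (z k *m (z k)^T).
  rewrite (bigD1 i) //= eqxx scale1r big1 ?addr0 // => k /negPf ->.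
  by rewrite scale0r.
have [|||c cE] := extreme_perturb De; rewrite ?outer_mul ?bil_outer //.
have := cE i; rewrite -(cE j) eqxx eq_sym (negPf ij) => /eqP.
by rewrite oner_eq0.
Qed.

End Extreme.

(** Single terms rule out a positive [bil Z d1 d2] and a vanishing [a ord0] or [a i1]. Playing these
    two terms against each other then forces rank two, where the two cone values cannot both be
    positive. *)
Lemma extreme_not_interior d1 d2 Z :
    spans_extreme_ray (qC2 d1 d2) Z -> (1 < \rank Z)%N ->
    0 < bil Q (Z *m d1) (Z *m d1) -> 0 < bil Q (Z *m d2) (Z *m d2) -> False.
Proof.
move=> Zext rk q1 q2; have [[pZ QZ k1 k2 k3] _ _] := Zext.
case rE: (\rank Z) rk => [//|[//|r]] _.
have [z Zz zQ] := isotropic_psd_decomp Qsym pZ QZ rE.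
pose a i := dot (z i) d1 * dot (z i) d2.
have term := extreme_term Zext rE Zz zQ.
have bE : bil Z d1 d2 = \sum_i a i.
  by rewrite Zz outer_sum1 bil_outer_sum; apply: eq_bigr => i _; rewrite mul1r.
pose i1 : 'I_r.+2 := lift ord0 ord0.
have i01 : ord0 != i1 by [].
have Zb : bil Z d1 d2 = 0.
  move: k3; rewrite le_eqVlt => /orP[/eqP <- //|b0].
  by exfalso; apply: (term ord0 i1) => //; left.
have a0 : a ord0 != 0.
  by apply/eqP => a0; apply: (term ord0 i1) => //; [left|left|right].
have a1 : a i1 != 0.
  by apply/eqP => a1; apply: (term i1 ord0) => //; [left|left|right].
(* These weights make the contributions of the two terms to [bil D d1 d2] cancel. *)
pose e i := if i == ord0 then a i1 else if i == i1 then - a ord0 else 0.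
have [|||c cE] := extreme_perturb Zext rE Zz zQ (erefl (\sum_i e i *: _)).
- by left.
- by left.
- right; rewrite bil_outer_sum (bigD1 ord0) // (bigD1 i1) //= big1 => [|i].
    by rewrite /e /= -!/(a _) addr0 mulNr mulrC subrr.
  by rewrite /e => /andP[/negPf -> /negPf ->]; rewrite mul0r.
have e01 : a i1 = - a ord0 by have := cE ord0; rewrite -(cE i1) /e.
(* In rank three or more, [ord_max] has weight 0, so constancy would give [a i1 = 0]. *)
case: r => [|r] in z zQ rE Zz a term bE i1 i01 a0 a1 e c cE e01 *; last first.
  have := cE ord0; rewrite -(cE ord_max) /e /= => a10.
  by rewrite a10 eqxx in a1.
have ZE d : Z *m d = dot (z ord0) d *: z ord0 + dot (z i1) d *: z i1.
  rewrite Zz outer_sum1 outer_sum_mul !big_ord_recl big_ord0 addr0 !mul1r.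
  by [].
have qE d : bil Q (Z *m d) (Z *m d)
    = 2 * dot (z ord0) d * dot (z i1) d * bil Q (z ord0) (z i1).
  rewrite ZE !(bilDl, bilDr, bilZl, bilZr) (bilC (z i1) _ Qsym) !zQ; ring.
(* With two terms this product is a square times [a ord0 * a i1], which is [- a ord0 ^+ 2]. *)
have : 0 < bil Q (Z *m d1) (Z *m d1) * bil Q (Z *m d2) (Z *m d2).
  exact: mulr_gt0.
have -> : bil Q (Z *m d1) (Z *m d1) * bil Q (Z *m d2) (Z *m d2)
  = (2 * bil Q (z ord0) (z i1)) ^+ 2 * (a ord0 * a i1).
  by rewrite !qE /a; ring.
rewrite e01 mulrN -expr2 mulrN -exprMn oppr_gt0 ltNge => /negP; apply.
exact: sqr_ge0.
Qed.

(** In the decomposition adapted to [d1], the second vector is orthogonal to [d1]. Perturbing by its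
    term changes neither [Z *m d1] nor [bil Z d1 d2], so the other cone constraint cannot be
    slack. *)
Lemma extreme_isotropic_imp d1 d2 Z :
    spans_extreme_ray (qC2 d1 d2) Z -> (1 < \rank Z)%N ->
    bil Q (Z *m d1) (Z *m d1) = 0 -> bil Q (Z *m d2) (Z *m d2) = 0.
Proof.
move=> Zext rk q1; have [[pZ QZ k1 k2 k3] _ _] := Zext.
case rE: (\rank Z) rk => [//|[//|r]] _.
have [z [Zz zQ zd]] := isotropic_psd_decomp_at Qsym pZ QZ q1 rE.
have [+ _] := k2; rewrite le_eqVlt => /orP[/eqP <- //|q2]; exfalso.
pose i1 : 'I_r.+2 := lift ord0 ord0.
apply: (@extreme_term _ _ _ _ _ Zext rE Zz zQ i1 ord0) => //.
- by right; exists 0; rewrite zd // !scale0r.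
- by left.
- by right; rewrite zd // mul0r.
Qed.

Lemma extreme_isotropic d1 d2 Z :
    spans_extreme_ray (qC2 d1 d2) Z -> (1 < \rank Z)%N ->
  bil Q (Z *m d1) (Z *m d1) = 0 /\ bil Q (Z *m d2) (Z *m d2) = 0.
Proof.
move=> Zext rk; have Zext' := Zext; rewrite qC2C in Zext'.
have [[_ _ [k1 _] [k2 _] _] _ _] := Zext.
have [q1|q1] := eqVneq (bil Q (Z *m d1) (Z *m d1)) 0.
  by split=> //; apply: extreme_isotropic_imp q1.
have [q2|q2] := eqVneq (bil Q (Z *m d2) (Z *m d2)) 0.
  by split=> //; apply: extreme_isotropic_imp q2.
by exfalso; apply: (extreme_not_interior Zext rk); rewrite lt_neqAle eq_sym ?q1 ?q2.
Qed.

Lemma decomp_at_mul r Z (z : 'I_r.+1 -> 'cV[R]_m) d :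
    Z = \sum_i z i *m (z i)^T -> (forall i, i != ord0 -> dot (z i) d = 0) ->
  Z *m d = dot (z ord0) d *: z ord0.
Proof.
move=> -> zd; rewrite outer_sum1 outer_sum_mul (bigD1 ord0) //= mul1r.
by rewrite big1 ?addr0 // => i i0; rewrite mul1r zd // scale0r.
Qed.

(** Here [bil Z d1 d2] is the product of the pairings of [z ord0] with [d1] and [d2]. If only the
    second vanished, the term of [z ord0] would send [d1] to [Z *m d1] and [d2] to 0, an admissible
    perturbation. *)
Lemma extreme_cross_eq0 d1 d2 Z :
    spans_extreme_ray (qC2 d1 d2) Z -> (1 < \rank Z)%N ->
  bil Z d1 d2 = 0 -> Z *m d1 = 0.
Proof.
move=> Zext rk b0; have [[pZ QZ k1 k2 k3] _ _] := Zext.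
have [q1 _] := extreme_isotropic Zext rk.
case rE: (\rank Z) rk => [//|[//|r]] _.
have [z [Zz zQ zd]] := isotropic_psd_decomp_at Qsym pZ QZ q1 rE.
have Zd1 := decomp_at_mul Zz zd.
have b : dot (z ord0) d1 * dot (z ord0) d2 = 0.
  by have [sZ _] := pZ; rewrite -b0 (bilC _ _ sZ) bil_dot Zd1 dotZr (dotC d2).
have [z1|z1] := eqVneq (dot (z ord0) d1) 0; first by rewrite Zd1 z1 scale0r.
have z2 : dot (z ord0) d2 = 0.
  by move/eqP: b; rewrite mulf_eq0 (negPf z1) => /eqP.
exfalso; apply: (@extreme_term _ _ _ _ _ Zext rE Zz zQ ord0 (lift ord0 ord0)) => //.
- by right; exists 1; rewrite Zd1 scale1r.
- by right; exists 0; rewrite z2 !scale0r.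
- by right.
Qed.

(** Otherwise [Z *m d1 = 0], so every [z i] is orthogonal to [d1]. In the decomposition adapted to
    [d2], the first term then kills [d1] and agrees with [Z] on [d2], again an admissible
    perturbation. *)
Lemma extreme_cross_gt0 d1 d2 Z :
  spans_extreme_ray (qC2 d1 d2) Z -> (1 < \rank Z)%N -> 0 < bil Z d1 d2.
Proof.
move=> Zext rk; have [[pZ QZ k1 k2 k3] _ _] := Zext.
rewrite lt_neqAle k3 andbT eq_sym; apply/eqP => b0.
have Z1 := extreme_cross_eq0 Zext rk b0.
have [_ q2] := extreme_isotropic Zext rk.
case rE: (\rank Z) rk => [//|[//|r]] _.
have [z [Zz zQ zd]] := isotropic_psd_decomp_at Qsym pZ QZ q2 rE.
have z1 : dot (z ord0) d1 = 0 by apply: outer_sum_ker; rewrite -Zz.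
apply: (@extreme_term _ _ _ _ _ Zext rE Zz zQ ord0 (lift ord0 ord0)) => //.
- by right; exists 0; rewrite z1 !scale0r.
- by right; exists 1; rewrite (decomp_at_mul Zz zd) scale1r.
- by right; rewrite z1 mul0r.
Qed.

End QuadraticCone.

(** * The concrete matrices, the Lorentz cone and lifted points *)

Section Lorentz.
Variables (R : realType) (n : nat).
Implicit Types (x c : 'cV[R]_n) (t s r : R) (w : 'cV[R]_(n + 1 + 1)).

Definition col3 x t s : 'cV[R]_(n + 1 + 1) := col_mx (col_mx x t%:M) s%:M.

Lemma col3P w : exists x t s, w = col3 x t s.
Proof.
exists (usubmx (usubmx w)), (dsubmx (usubmx w) 0 0), (dsubmx w 0 0).
by rewrite /col3 -!mx11_scalar !vsubmxK.
Qed.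

Lemma dot_col_mx p q (u u' : 'cV[R]_p) (v v' : 'cV[R]_q) :
  dot (col_mx u v) (col_mx u' v') = dot u u' + dot v v'.
Proof. by rewrite /dot tr_col_mx mul_row_col mxE. Qed.

Lemma dot_scalar t s : dot (t%:M : 'cV[R]_1) s%:M = t * s.
Proof. by rewrite dotE big_ord1 !mxE eqxx !mulr1n. Qed.

Lemma dot_col3 x x' t t' s s' :
  dot (col3 x t s) (col3 x' t' s') = dot x x' + t * t' + s * s'.
Proof. by rewrite !dot_col_mx !dot_scalar. Qed.

Lemma Qmx_col3 x t s : Qmx R n *m col3 x t s = col3 (- 2 *: x) s t.
Proof.
rewrite /Qmx /col3 !mul_block_col !mul_scalar_mx !mul0mx ?mul_row_col.
rewrite !addr0 mul0mx add0r mul1mx mul_col_mx mul0mx mul1mx add_col_mx addr0 add0r.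
by [].
Qed.

Lemma Pmx_col3 x t s : Pmx R n *m col3 x t s = col3 (2 *: x) (t - s) (t + s).
Proof.
rewrite /Pmx /col3 !mul_block_col !mul_row_col !mul0mx !mul_scalar_mx.
rewrite mul_col_mx !mul0mx add_col_mx !addr0 !add0r !mul_scalar_mx !scale1r scaleN1r.
by rewrite -raddfB -raddfD.
Qed.

Lemma Qmx_sym : (Qmx R n)^T = Qmx R n.
Proof.
by rewrite /Qmx !tr_block_mx tr_col_mx tr_row_mx !tr_scalar_mx !trmx0.
Qed.

Lemma bil_Qmx x t s :
  bil (Qmx R n) (col3 x t s) (col3 x t s) = 2 * (t * s - dot x x).
Proof. by rewrite bil_dot Qmx_col3 dot_col3 dotZr; ring. Qed.

(** Plays the role of [l]: its pairing with [w] is the last coordinate of [Pmx R n *m w]. *)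
Definition axis : 'cV[R]_(n + 1 + 1) := col3 0 1 1.

Lemma dot_axis x t s : dot axis (col3 x t s) = t + s.
Proof. by rewrite dot_col3 /dot trmx0 mul0mx mxE add0r !mul1r. Qed.

(** A positive form means [t * s > dot x x], which [t = - s] contradicts. *)
Lemma bil_Qmx_axis w : 0 < bil (Qmx R n) w w -> dot axis w != 0.
Proof.
have [x [t [s ->]]] := col3P w; rewrite bil_Qmx dot_axis => h.
have := dot_ge0 x => x0; apply/eqP => ts.
have : t = - s by lra.
by move=> tE; move: h; rewrite tE; have := sqr_ge0 s; rewrite expr2; lra.
Qed.

(** By [(t + s) ^+ 2 - (t - s) ^+ 2 = 4 * t * s], [Pmx] carries twice the form of [Qmx] to the
    Lorentz form. *)
Lemma norm2_Pmx x t s :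
  norm2 (usubmx (Pmx R n *m col3 x t s)) ^+ 2
  = (t + s) ^+ 2 - 2 * bil (Qmx R n) (col3 x t s) (col3 x t s).
Proof.
rewrite Pmx_col3 col_mxKu norm2_sqr dot_col_mx dot_scalar dotZr dotZl bil_Qmx.
by ring.
Qed.

Lemma last_Pmx x t s : dsubmx (Pmx R n *m col3 x t s) 0 0 = t + s.
Proof. by rewrite Pmx_col3 col_mxKd mxE eqxx mulr1n. Qed.

Lemma lorentz_Pmx w : lorentz (Pmx R n *m w) <-> qcone (Qmx R n) axis w.
Proof.
have [x [t [s ->]]] := col3P w; rewrite /lorentz /qcone /= last_Pmx dot_axis.
have h := norm2_Pmx x t s; have n0 := norm2_ge0 (usubmx (Pmx R n *m col3 x t s)).
split=> [ns|[q0 ts0]].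
  have ts := le_trans n0 ns; split=> //.
  by move: ns; rewrite -ler_sqr ?nnegrE // h; lra.
by rewrite -ler_sqr ?nnegrE // h; lra.
Qed.

Lemma C2E c1 c2 r1 r2 :
  C2 c1 c2 r1 r2 = qC2 (Qmx R n) axis (dvec c1 r1) (dvec c2 r2).
Proof.
by apply/seteqP; split=> Z [pZ QZ k1 k2 k3]; split=> //; move: k1 k2;
  rewrite -!mulmxA => /lorentz_Pmx ? /lorentz_Pmx ?.
Qed.

(* Lowering the last coordinate of such a [v] by any amount leaves the cone. *)
Lemma bd_lorentz m (v : 'cV[R]_(m + 1)) :
  norm2 (usubmx v) = dsubmx v 0 0 -> bd (@lorentz R m) v.
Proof.
move=> vE; split; first by apply: subset_closure; rewrite /lorentz /= vE.
move=> [P Pv PL].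
have [e /= e0 he] := (iffLR (nbhs_ballP _ _)) (Pv (rshift m 0) 0).
pose v' : 'cV[R]_(m + 1) := col_mx (usubmx v) (dsubmx v - (e / 2)%:M).
have : lorentz v'.
  apply: PL => i j; rewrite ord1 /v' -[i]splitK; case: (fintype.split i) => k /=.
    rewrite col_mxEu mxE; exact: nbhs_singleton (Pv _ _).
  rewrite col_mxEd ord1 !mxE eqxx mulr1n; apply: he.
  rewrite /ball /= opprB addrC subrK gtr0_norm ?divr_gt0 //.
  by rewrite ltr_pdivrMr // ltr_pMr // ltr1n.
rewrite /lorentz /= col_mxKu vE col_mxKd !mxE eqxx mulr1n.
by apply/negP; rewrite -ltNge ltrBlDr ltrDl divr_gt0.
Qed.

Lemma bd_lorentz_Pmx w : qcone (Qmx R n) axis w -> bil (Qmx R n) w w = 0 ->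
  bd (@lorentz R (n + 1)) (Pmx R n *m w).
Proof.
have [x [t [s ->]]] := col3P w; rewrite /qcone /= dot_axis => -[_ ts] q0.
apply: bd_lorentz; rewrite last_Pmx.
apply/eqP; rewrite -(eqrXn2 (n := 2)) ?norm2_ge0 //.
by rewrite norm2_Pmx q0 mulr0 subr0.
Qed.

Lemma dot_dvec c r x t s :
  dot (col3 x t s) (dvec c r) = 2 * dot x c - t + s * (r ^+ 2 - dot c c).
Proof. by rewrite dot_col3 dotZr norm2_sqr; ring. Qed.

Lemma norm2_subsqr x c : norm2 (x - c) ^+ 2 = dot x x - 2 * dot x c + dot c c.
Proof.
by rewrite norm2_sqr dotBr !(dotC (x - c)) !dotBr (dotC c x); ring.
Qed.

(** Isotropy reads [t * s = dot x x], so [t / s] is the squared norm of [s^-1 *: x]. *)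
Lemma isotropic_lift x t s : s != 0 ->
    bil (Qmx R n) (col3 x t s) (col3 x t s) = 0 ->
  col3 x t s = s *: paraboloid_lift (s^-1 *: x).
Proof.
move=> s0 /eqP; rewrite bil_Qmx mulf_eq0 pnatr_eq0 /= subr_eq0 => /eqP ts.
rewrite /paraboloid_lift /col3 !scale_col_mx !scale_scalar_mx mulr1 scalerA.
rewrite divff // scale1r norm2_sqr dotZr dotZl -ts.
by congr (col_mx (col_mx _ _%:M) _); field.
Qed.

(** For [0 <= r], the sign of this pairing tells whether [x] is inside, on or outside the sphere. *)
Lemma dot_dvec_lift c r x :
  dot (paraboloid_lift x) (dvec c r) = r ^+ 2 - norm2 (x - c) ^+ 2.
Proof. by rewrite dot_dvec norm2_subsqr norm2_sqr; ring. Qed.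

Lemma isotropic_last0 x t :
  bil (Qmx R n) (col3 x t 0) (col3 x t 0) = 0 -> col3 x t 0 = t *: col3 0 1 0.
Proof.
move=> /eqP; rewrite bil_Qmx mulf_eq0 pnatr_eq0 /= mulr0 sub0r oppr_eq0.
by move=> /eqP /dot_eq0 ->; rewrite /col3 !scale_col_mx !scale_scalar_mx !scaler0 mulr1 mulr0.
Qed.

Lemma dot_infinity c r : dot (col3 0 1 0) (dvec c r) = -1.
Proof. by rewrite dot_dvec /dot trmx0 mul0mx mxE; ring. Qed.

(* The only isotropic direction that is not a multiple of a lifted point is
   [col3 0 1 0], the point at infinity, where every [dvec c r] is negative. *)
Lemma isotropic_lift_dot0 c r w : bil (Qmx R n) w w = 0 -> w != 0 ->
    0 <= r -> dot w (dvec c r) = 0 ->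
  exists y a, [/\ a != 0, w = a *: paraboloid_lift y & norm2 (y - c) = r].
Proof.
have [x [t [s ->]]] := col3P w => q0 w0 r0.
have [s0|s0] := eqVneq s 0.
  rewrite s0 in q0 w0 *; rewrite (isotropic_last0 q0) in w0 *.
  rewrite dotZl dot_infinity mulrN1 => /eqP; rewrite oppr_eq0 => /eqP t0.
  by rewrite t0 scale0r eqxx in w0.
rewrite (isotropic_lift s0 q0) dotZl dot_dvec_lift => /eqP.
rewrite mulf_eq0 (negPf s0) /= subr_eq0 => /eqP rE.
exists (s^-1 *: x), s; split=> //.
by apply/eqP; rewrite -(eqrXn2 (n := 2)) ?norm2_ge0 // rE.
Qed.

(** At infinity the two products would be [- t ^+ 2] and [t ^+ 2], which is impossible. At a lifted
    point the first gives [0 <= a1], and [0 < a1 * a2] makes both strict. *)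
Lemma isotropic_lift_interior c1 r1 c2 r2 w : bil (Qmx R n) w w = 0 ->
    0 <= r1 -> 0 <= r2 ->
    0 <= dot w (dvec c1 r1) * dot axis w ->
    0 < dot w (dvec c1 r1) * dot w (dvec c2 r2) ->
  exists y a, [/\ a != 0, w = a *: paraboloid_lift y,
    norm2 (y - c1) < r1 & norm2 (y - c2) < r2].
Proof.
have [x [t [s ->]]] := col3P w => q0 r10 r20.
have [s0|s0] := eqVneq s 0.
  rewrite s0 in q0 *; rewrite (isotropic_last0 q0).
  rewrite !dotZl dotZr !dot_infinity dot_axis.
  by have := sqr_ge0 t; rewrite expr2; lra.
rewrite (isotropic_lift s0 q0); set y := s^-1 *: x.
rewrite !dotZl dotZr !dot_dvec_lift.
set a1 := r1 ^+ 2 - _; set a2 := r2 ^+ 2 - _.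
have -> : dot axis (paraboloid_lift y) = norm2 y ^+ 2 + 1 by rewrite dot_axis.
have y0 : 0 < norm2 y ^+ 2 + 1 by rewrite ltr_pwDr // sqr_ge0.
have ss : 0 < s ^+ 2 by rewrite lt_neqAle eq_sym expf_eq0 /= s0 sqr_ge0.
have -> : s * a1 * (s * (norm2 y ^+ 2 + 1)) = (s ^+ 2 * (norm2 y ^+ 2 + 1)) * a1.
  by ring.
have -> : s * a1 * (s * a2) = s ^+ 2 * (a1 * a2) by ring.
rewrite (pmulr_rge0 _ (mulr_gt0 ss y0)) (pmulr_rgt0 _ ss) => a1ge a12.
have a1gt : 0 < a1.
  by rewrite lt_neqAle a1ge andbT eq_sym; apply: contraTneq a12 => ->; rewrite mul0r ltxx.
move: (a12); rewrite (pmulr_rgt0 _ a1gt) => a2gt.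
exists y, s; split=> //.
  by rewrite -ltr_sqr ?nnegrE ?norm2_ge0 // -subr_gt0.
by rewrite -ltr_sqr ?nnegrE ?norm2_ge0 // -subr_gt0.
Qed.

End Lorentz.

Theorem theorem4 (R : realType) (n : nat) (n_ge1 : (1 <= n)%N)
    (c1 c2 : 'cV[R]_n) (r1 r2 : R)
    (S_nonempty :
       [set x : 'cV[R]_n | norm2 (x - c1) <= r1 /\ norm2 (x - c2) <= r2] !=set0)
    (Z : 'M[R]_(n + 1 + 1))
    (Z_extreme : spans_extreme_ray (C2 c1 c2 r1 r2) Z)
    (rank_gt1 : (1 < \rank Z)%N) :
  exists (x : 'I_(\rank Z) -> 'cV[R]_n) (alpha : 'I_(\rank Z) -> R),
    (forall i, 0 < alpha i) /\
    Z = \sum_(i < \rank Z)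
          alpha i *: (paraboloid_lift (x i) *m (paraboloid_lift (x i))^T) /\
    (forall i : 'I_(\rank Z), i = 0%N :> nat ->
       norm2 (x i - c1) < r1 /\ norm2 (x i - c2) < r2) /\
    (forall i : 'I_(\rank Z), (1 <= i)%N -> norm2 (x i - c1) = r1) /\
    bd (@lorentz R (n + 1)) (Pmx R n *m Z *m dvec c2 r2).
Proof.
(* A common point of the balls makes both radii nonnegative. *)
have [x0 [/(le_trans (norm2_ge0 _)) r1_ge0 /(le_trans (norm2_ge0 _)) r2_ge0]] :=
  S_nonempty.
rewrite C2E in Z_extreme.
have Qsym := Qmx_sym R n; have Ql := @bil_Qmx_axis R n.
have [[pZ QZ k1 k2 k3] _ _] := Z_extreme.
have [q1 q2] := extreme_isotropic Qsym Ql Z_extreme rank_gt1.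
have b_gt0 := extreme_cross_gt0 Qsym Ql Z_extreme rank_gt1.
have bdP : bd (@lorentz R (n + 1)) (Pmx R n *m Z *m dvec c2 r2).
  by rewrite -mulmxA; apply: bd_lorentz_Pmx.
case rE: (\rank Z) rank_gt1 => [//|r] _.
have [z [Zz zQ zd]] := isotropic_psd_decomp_at Qsym pZ QZ q1 rE.
(* A zero [z i] could have coefficient 1 or 0 without changing the sum, against [outer_sum_inj]. *)
have z_neq0 i : z i != 0.
  apply/eqP => zi0.
  have E : \sum_k (1 : R) *: (z k *m (z k)^T)
      = \sum_k (k != i)%:R *: (z k *m (z k)^T).
    apply: eq_bigr => k _.
    by have [->|_] := eqVneq k i; rewrite // zi0 mul0mx !scaler0.
  rewrite Zz in rE; have := outer_sum_inj rE E i.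
  by rewrite eqxx => /eqP; rewrite oner_eq0.
have Zd1 := decomp_at_mul Zz zd.
have bE : bil Z (dvec c1 r1) (dvec c2 r2)
    = dot (z ord0) (dvec c1 r1) * dot (z ord0) (dvec c2 r2).
  by have [sZ _] := pZ; rewrite (bilC _ _ sZ) bil_dot Zd1 dotZr (dotC (dvec c2 r2)).
(* Since [Z *m d1] is a multiple of [z ord0], the first cone constraint and the positive cross term
   become the two sign conditions on [z ord0]. *)
have [] := @isotropic_lift_interior R n c1 r1 c2 r2 (z ord0) (zQ _) r1_ge0 r2_ge0.
- by have [_] := k1; rewrite Zd1 dotZr.
- by rewrite -bE.
move=> y0 [a0 [a0_neq0 z0E y0c1 y0c2]].
have /boolp.choice[ya yaP] : forall i, exists ya : 'cV[R]_n * R,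
    [/\ ya.2 != 0, z i = ya.2 *: paraboloid_lift ya.1 &
      if i == ord0 then norm2 (ya.1 - c1) < r1 /\ norm2 (ya.1 - c2) < r2
      else norm2 (ya.1 - c1) = r1].
  move=> i; have [->|i0] := eqVneq i ord0; first by exists (y0, a0).
  have [y [a [an zE yc]]] := isotropic_lift_dot0 (zQ i) (z_neq0 i) r1_ge0 (zd _ i0).
  by exists (y, a).
(* The scalars may be negative, but the outer product squares them. *)
exists (fun i => (ya i).1), (fun i => (ya i).2 ^+ 2); split.
  by move=> i; have [a_neq0 _ _] := yaP i; rewrite lt_neqAle eq_sym expf_eq0 sqr_ge0 a_neq0.
split.
  rewrite Zz; apply: eq_bigr => i _; have [_ -> _] := yaP i.
  by rewrite linearZ /= -scalemxAl -scalemxAr scalerA -expr2.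
split.
  move=> i i0; have [_ _] := yaP i.
  by have -> : i = ord0 by apply: val_inj.
split=> // i i_gt0; have [_ _] := yaP i.
by case: eqP i_gt0 => // ->.
Qed.
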